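(* Let $(a,b,c)$ be a primitive Pythagorean triple. Then the rank of the elliptic curve $$y^2=x(x-a^2)(x+c^2)$$ over $\mathbb{Q}$ is positive.
   Context: A primitive Pythagorean triple (PPT) is a triple $(a,b,c)$ of positive integers with $a^2+b^2=c^2$ and $\gcd(a,b,c)=1$. The rank of an elliptic curve $E$ over $\mathbb{Q}$ is the nonnegative integer $r$ such that $E(\mathbb{Q})\cong\mathbb{Z}^r\times E(\mathbb{Q})_{\mathrm{tors}}$. *)

(* Defs.v *)
From mathcomp Require Import all_boot all_order all_algebra all_field.
From mathcomp Require Import ring lra.

Set Implicit Arguments.
Unset Strict Implicit.
Unset Printing Implicit Defensive.

Import Order.TTheory GRing.Theory Num.Theory.
Local Open Scope ring_scope.

Definition primitive_pythagorean_triple (a b c : nat) : Prop :=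
  [/\ [/\ (0 < a)%N, (0 < b)%N & (0 < c)%N],
      (a ^ 2 + b ^ 2 = c ^ 2)%N
    & gcdn a (gcdn b c) = 1%N].

(* The curve y^2 = f(x) over Q together with its point at infinity, where f is
   a monic cubic; separability of f is smoothness of the curve. *)
Record elliptic_curve := EllipticCurve {
  cubic : {poly rat};
  cubic_monic : cubic \is monic;
  size_cubic : size cubic = 4%N;
  cubic_separable : separable_poly cubic }.

(* None is the point at infinity. *)
Definition on_curve (E : elliptic_curve) (P : option (rat * rat)) : bool :=
  if P is Some (x, y) then y ^+ 2 == (cubic E).[x] else true.

Record point (E : elliptic_curve) := Point {
  coords : option (rat * rat);
  coords_on_curve : on_curve E coords }.

Definition point0 (E : elliptic_curve) : point E := @Point E None isT.

(* The line of slope l through (x1, y1) and (x2, y2) meets the curve in a third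
   point, whose abscissa comes from the sum of the roots of f - (line)^2; the
   sum is the reflection of that point in the x-axis. *)
Definition line_sum (E : elliptic_curve) (l x1 y1 x2 : rat) : rat * rat :=
  let x3 := l ^+ 2 - (cubic E)`_2 - x1 - x2 in
  (x3, l * (x1 - x3) - y1).

Definition add_coords (E : elliptic_curve) (P Q : option (rat * rat)) :
    option (rat * rat) :=
  match P, Q with
  | None, _ => Q
  | _, None => P
  | Some (x1, y1), Some (x2, y2) =>
      if x1 != x2 then Some (line_sum E ((y2 - y1) / (x2 - x1)) x1 y1 x2)
      else if y1 == - y2 then None
      else Some (line_sum E ((cubic E)^`().[x1] / (2 * y1)) x1 y1 x2)
  end.

Lemma horner_cubic (E : elliptic_curve) (x : rat) :
  (cubic E).[x] =
    x ^+ 3 + (cubic E)`_2 * x ^+ 2 + (cubic E)`_1 * x + (cubic E)`_0.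
Proof.
have f3 : (cubic E)`_3 = 1.
  by have /monicP := cubic_monic E; rewrite lead_coefE size_cubic.
rewrite horner_coef size_cubic !big_ord_recr big_ord0 /= f3; ring.
Qed.

Lemma horner_deriv_cubic (E : elliptic_curve) (x : rat) :
  (cubic E)^`().[x] = 3 * x ^+ 2 + 2 * (cubic E)`_2 * x + (cubic E)`_1.
Proof.
have f3 : (cubic E)`_3 = 1.
  by have /monicP := cubic_monic E; rewrite lead_coefE size_cubic.
have sz : (size (cubic E)^`() <= 3)%N.
  rewrite -ltnS -(size_cubic E) lt_size_deriv //.
  by rewrite monic_neq0 ?cubic_monic.
rewrite (horner_coef_wide _ sz) !big_ord_recr big_ord0 /= !coef_deriv f3; ring.
Qed.

Lemma add_coords_on_curve (E : elliptic_curve) (P Q : option (rat * rat)) :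
  on_curve E P -> on_curve E Q -> on_curve E (add_coords E P Q).
Proof.
case: P Q => [[x1 y1]|] [[x2 y2]|] //= /eqP h1 /eqP h2.
case: eqP => [ex|/eqP nx] /=; last first.
  have d : x2 - x1 != 0 by rewrite subr_eq0 eq_sym.
  move: h1 h2; rewrite !horner_cubic.
  set s := _`_2; set t := _`_1; set u := _`_0 => h1 h2.
  have eu : u = y1 ^+ 2 - x1 ^+ 3 - s * x1 ^+ 2 - t * x1 by rewrite h1; ring.
  have et : t = (y2 ^+ 2 - y1 ^+ 2 - (x2 ^+ 3 - x1 ^+ 3)
                 - s * (x2 ^+ 2 - x1 ^+ 2)) / (x2 - x1).
    by rewrite h1 h2; field.
  by apply/eqP; rewrite eu et; field.
case: eqP => //= ny; subst x2.
have ey : y1 = y2.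
  have /eqP : (y1 - y2) * (y1 + y2) = 0.
    by transitivity (y1 ^+ 2 - y2 ^+ 2); [ring | rewrite h1 h2 subrr].
  by rewrite mulf_eq0 subr_eq0 addr_eq0 => /orP[/eqP|/eqP].
have y0 : y1 != 0 by apply/eqP => y0; apply: ny; rewrite -ey y0 oppr0.
move: h1; rewrite !horner_cubic horner_deriv_cubic.
set s := _`_2; set t := _`_1; set u := _`_0 => h1.
have eu : u = y1 ^+ 2 - x1 ^+ 3 - s * x1 ^+ 2 - t * x1 by rewrite h1; ring.
by apply/eqP; rewrite eu; field.
Qed.

Definition addp (E : elliptic_curve) (P Q : point E) : point E :=
  Point (add_coords_on_curve (coords_on_curve P) (coords_on_curve Q)).

Definition torsion (E : elliptic_curve) (P : point E) : Prop :=
  exists2 n : nat, (0 < n)%N & iter n (addp P) (point0 E) = point0 E.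

(* E(Q) is isomorphic to Z^r x E(Q)_tors: an injective homomorphism from E(Q)
   to Z^r x E(Q) whose image is exactly Z^r x E(Q)_tors. *)
Definition has_rank (E : elliptic_curve) (r : nat) : Prop :=
  exists f : point E -> 'rV[int]_r * point E,
    [/\ forall P Q, f (addp P Q) =
          ((f P).1 + (f Q).1, addp (f P).2 (f Q).2),
        injective f
      & forall v T, (exists P, f P = (v, T)) <-> torsion T].

Definition ppt_cubic (a c : nat) : {poly rat} :=
  'X * ('X - (a%:R ^+ 2)%:P) * ('X + (c%:R ^+ 2)%:P).

Lemma ppt_cubicE (a c : nat) :
  ppt_cubic a c =
    \prod_(z <- [:: 0; a%:R ^+ 2; - c%:R ^+ 2]) ('X - z%:P).
Proof. by rewrite !big_cons big_nil mulr1 subr0 polyCN opprK mulrA. Qed.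

Lemma ppt_cubic_monic (a c : nat) : ppt_cubic a c \is monic.
Proof. by rewrite ppt_cubicE monic_prod_XsubC. Qed.

Lemma size_ppt_cubic (a c : nat) : size (ppt_cubic a c) = 4%N.
Proof. by rewrite ppt_cubicE size_prod_XsubC. Qed.

Lemma ppt_cubic_separable (a b c : nat) :
  primitive_pythagorean_triple a b c -> separable_poly (ppt_cubic a c).
Proof.
case=> [[a0 _ c0] _ _]; rewrite ppt_cubicE separable_prod_XsubC /= !inE.
have ha : 0 < a%:R ^+ 2 :> rat by rewrite exprn_gt0 // ltr0n.
have hc : 0 < c%:R ^+ 2 :> rat by rewrite exprn_gt0 // ltr0n.
by rewrite negb_or !andbT; apply/andP; split; [apply/andP; split|]; lra.
Qed.

Definition ppt_curve (a b c : nat) (abc : primitive_pythagorean_triple a b c) :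
    elliptic_curve :=
  EllipticCurve (ppt_cubic_monic a c) (size_ppt_cubic a c)
    (ppt_cubic_separable abc).

(* Main.v *)
Require Import Defs.
From mathcomp Require Import all_boot all_order all_algebra.
From mathcomp Require Import ring zify.

(** Rank 0 makes every rational point torsion, so it is enough to exhibit a
    point of infinite order.

    With b^2 = c^2 - a^2 the curve is y^2 = x^3 + b^2 x^2 - a^2 c^2 x, and it
    carries the point P = (-b^2, abc).  Put N = b^4 + a^2 c^2.  The double of P
    has abscissa (N / (2abc))^2, and N = a^4 + a^2 b^2 + b^4 is odd because a
    and b are not both even; so 2P is 2-adically close to the point at infinity
    without being equal to it.  By the Nagell-Lutz phenomenon such a point has
    infinite order ([near_infinity_nontorsion]).

    The multiples of a point Q are here the iterates of the translation
    X |-> Q + X, and the argument avoids the associativity of the group law by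
    studying this translation as a p-adic dynamical system.  In the coordinates
    z = x / y, w = 1 / y the neighbourhood of infinity is z = w = 0 (mod p), and
    there z(Q + X) = z(Q) + z(X) + shift, where shift is a rational function of
    the coordinates of Q and X that vanishes when X is the point at infinity
    ([add_near_infinity]).  It contracts strongly: moving X by p^j in the
    coordinate z moves shift only by p^(j + 2) ([shift_lipschitz]).  Hence the
    displacement z(Q + X) - z(X) has the p-adic valuation k of z(Q) at every X
    with p^k | z(X).  A map whose displacement has constant valuation and
    contracts by p^2 has no periodic point ([no_periodic_point]): a number n of
    iterations prime to p multiplies the displacement by n up to higher order
    terms, and p iterations give a map of the same kind, of valuation k + 1. *)

Set Implicit Arguments.
Unset Strict Implicit.
Unset Printing Implicit Defensive.

Import Order.TTheory GRing.Theory Num.Theory.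
Local Open Scope ring_scope.

(** * Divisibility by powers of a prime in the local ring at p *)

(** Divisibility of q by p ^ k in the ring of rationals whose denominator is
    prime to p; for k = 0 it says that q belongs to that ring. *)
Definition pdvd (p k : nat) (q : rat) : Prop :=
  exists m n : int, ~~ (p %| n)%Z /\ q = p%:R ^+ k * m%:~R / n%:~R.

Lemma ndvdz_neq0 (p : nat) (n : int) : ~~ (p %| n)%Z -> n%:~R != 0 :> rat.
Proof.
by move=> pn; rewrite intr_eq0; apply: contraNneq pn => ->; rewrite dvdz0.
Qed.

Lemma ndvdzM (p : nat) (m n : int) : prime p ->
  ~~ (p %| m)%Z -> ~~ (p %| n)%Z -> ~~ (p %| m * n)%Z.
Proof.
by move=> pp; rewrite !dvdzE abszM /= Euclid_dvdM // negb_or => -> ->.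
Qed.

Lemma pdvd_int (p : nat) (m : int) : prime p -> pdvd p 0 m%:~R.
Proof.
move=> pp; exists m, 1; split; last by rewrite expr0 mul1r divr1.
by rewrite dvdzE /= dvdn1; case: p pp => [|[]].
Qed.

Lemma pdvd_nat (p n : nat) : prime p -> pdvd p 0 n%:R.
Proof. by move=> pp; have := pdvd_int n pp; rewrite -pmulrn. Qed.

Lemma pdvd0 (p k : nat) : prime p -> pdvd p k 0.
Proof.
move=> pp; have [_ [n [pn _]]] := pdvd_int 0 pp.
by exists 0, n; rewrite mulr0 mul0r.
Qed.

Lemma pdvd_p (p : nat) : prime p -> pdvd p 1 p%:R.
Proof.
move=> pp; have [_ [n [pn _]]] := pdvd_int 1 pp.
by exists n, n; rewrite expr1 mulfK // (ndvdz_neq0 pn).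
Qed.

Lemma pdvdM (p i j k : nat) (a b : rat) : prime p -> (k <= i + j)%N ->
  pdvd p i a -> pdvd p j b -> pdvd p k (a * b).
Proof.
move=> pp kij [m [n [pn ->]]] [m' [n' [pn' ->]]].
exists ((p%:Z ^+ (i + j - k)) * m * m'), (n * n'); split; first exact: ndvdzM.
have -> : p%:R ^+ k * (p%:Z ^+ (i + j - k) * m * m')%:~R / (n * n')%:~R
    = p%:R ^+ (k + (i + j - k)) * m%:~R * m'%:~R / (n%:~R * n'%:~R) :> rat.
  by rewrite exprD !rmorphM /= rmorphXn /= -pmulrn !mulrA.
rewrite subnKC // exprD; field.
by rewrite (ndvdz_neq0 pn) (ndvdz_neq0 pn').
Qed.

Lemma pdvdW (p i k : nat) (a : rat) : prime p -> (k <= i)%N ->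
  pdvd p i a -> pdvd p k a.
Proof.
by move=> pp ki pa; rewrite -[a]mulr1; apply: pdvdM pa (pdvd_nat 1 pp); lia.
Qed.

Lemma pdvdMl (p k : nat) (a b : rat) : prime p ->
  pdvd p 0 a -> pdvd p k b -> pdvd p k (a * b).
Proof. by move=> pp; apply: pdvdM. Qed.

Lemma pdvdMr (p k : nat) (a b : rat) : prime p ->
  pdvd p k a -> pdvd p 0 b -> pdvd p k (a * b).
Proof. by move=> pp; apply: pdvdM; rewrite ?addn0. Qed.

Lemma pdvdD (p k : nat) (a b : rat) : prime p ->
  pdvd p k a -> pdvd p k b -> pdvd p k (a + b).
Proof.
move=> pp [m [n [pn ->]]] [m' [n' [pn' ->]]].
exists (m * n' + m' * n), (n * n'); split; first exact: ndvdzM.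
rewrite !(rmorphD, rmorphM) /=; field.
by rewrite (ndvdz_neq0 pn) (ndvdz_neq0 pn').
Qed.

Lemma pdvdN (p k : nat) (a : rat) : prime p -> pdvd p k a -> pdvd p k (- a).
Proof.
by move=> pp pa; rewrite -mulN1r; apply: pdvdMl => //; apply: (pdvd_int (-1)).
Qed.

Lemma pdvdB (p k : nat) (a b : rat) : prime p ->
  pdvd p k a -> pdvd p k b -> pdvd p k (a - b).
Proof. by move=> pp pa pb; apply: pdvdD => //; apply: pdvdN. Qed.

Lemma pdvd_sum (p k n : nat) (F : nat -> rat) : prime p ->
  (forall i, pdvd p k (F i)) -> pdvd p k (\sum_(i < n) F i).
Proof.
move=> pp pF; elim: n => [|n IHn]; first by rewrite big_ord0; apply: pdvd0.
by rewrite big_ord_recr /=; apply: pdvdD.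
Qed.

Lemma pdvd_natMl (p k n : nat) (a : rat) : prime p -> ~~ (p %| n)%N ->
  pdvd p k (n%:R * a) -> pdvd p k a.
Proof.
move=> pp pn pna.
have n0 : n%:R != 0 :> rat by rewrite pnatr_eq0; case: n pn {pna}; rewrite ?dvdn0.
rewrite -(mulKf n0 a) mulrC; apply: pdvdMr => //.
by exists 1, n%:Z; rewrite expr0 !mul1r -pmulrn.
Qed.

Lemma pdvd_pMl (p k : nat) (a : rat) : prime p ->
  pdvd p k.+1 (p%:R * a) -> pdvd p k a.
Proof.
move=> pp [m [n [pn e]]]; exists m, n; split=> //.
have p0 : p%:R != 0 :> rat by rewrite pnatr_eq0 -lt0n prime_gt0.
by apply: (mulfI p0); rewrite e exprS !mulrA.
Qed.

Lemma pdvd1 (p : nat) : prime p -> ~ pdvd p 1 1.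
Proof.
move=> pp [m [n [pn]]] e; move: (pn).
suff -> : n = p%:Z * m by rewrite dvdz_mulr.
apply/eqP; rewrite -(inj_eq (@intr_inj rat)) rmorphM /= -pmulrn; apply/eqP.
by rewrite -[RHS](divfK (ndvdz_neq0 pn)) -{1}[p%:R]expr1 -e mul1r.
Qed.

Lemma punit_neq0 (p : nat) (x : rat) : prime p -> pdvd p 1 (1 - x) -> x != 0.
Proof.
by move=> pp; apply: contraPneq => ->; rewrite subr0; apply: pdvd1.
Qed.

Lemma pdvd_div (p k : nat) (a x : rat) : prime p ->
  pdvd p 1 (1 - x) -> pdvd p k a -> pdvd p k (a / x).
Proof.
move=> pp ux pa; apply: pdvdMr => //.
have x0 := punit_neq0 pp ux; case: ux => m [n [pn e]].
have nn := ndvdz_neq0 pn.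
have ex : x = (n - p%:Z * m)%:~R / n%:~R.
  rewrite rmorphB rmorphM /= -pmulrn mulrBl divff //.
  by move: e; rewrite expr1 => <-; ring.
exists n, (n - p%:Z * m); split; last by rewrite expr0 mul1r ex invf_div.
by rewrite rpredBr ?dvdz_mulr //.
Qed.

(** Congruence of quotients with denominators that are 1 modulo p: the
    denominators need only agree after multiplication by the numerator, which
    itself may be divisible by p. *)
Lemma pdvd_cong_div (p k : nat) (a b x y : rat) : prime p ->
  pdvd p 1 (1 - x) -> pdvd p 1 (1 - y) ->
  pdvd p k (a - b) -> pdvd p k (b * (x - y)) -> pdvd p k (a / x - b / y).
Proof.
move=> pp ux uy ab bxy; have x0 := punit_neq0 pp ux; have y0 := punit_neq0 pp uy.
have -> : a / x - b / y = (a - b) / x - b * (x - y) / x / y by field; rewrite x0 y0.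
by apply: pdvdB => //; do ?apply: pdvd_div.
Qed.

Lemma exact_pdvd (p i : nat) (q : rat) : prime p -> q != 0 -> pdvd p i q ->
  exists k, [/\ (i <= k)%N, pdvd p k q & ~ pdvd p k.+1 q].
Proof.
move=> pp q0 [m [n [pn e]]].
have m0 : (0 < `|m|)%N.
  by rewrite absz_gt0; apply: contraNneq q0 => m0; rewrite e m0 mulr0 mul0r.
have [d pd ed] := pfactor_coprime pp m0.
have em : m = (-1) ^+ (m < 0)%R * (d%:Z * p%:Z ^+ logn p `|m|).
  by rewrite {1}[m]intEsign {1}ed PoszM -[Posz (p ^ _)]natz natrX natz.
set j := logn p _ in em.
have pz : p%:R != 0 :> rat by rewrite pnatr_eq0 -lt0n prime_gt0.
have nn := ndvdz_neq0 pn.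
have eq : q = p%:R ^+ (i + j) * ((-1) ^+ (m < 0)%R * d%:Z)%:~R / n%:~R.
  by rewrite e {1}em exprD !(rmorphM, rmorphXn) /= -!pmulrn; ring.
exists (i + j)%N; split; first exact: leq_addr.
  by exists ((-1) ^+ (m < 0)%R * d%:Z), n.
move=> [m' [n' [pn' e']]].
have nn' := ndvdz_neq0 pn'.
have : ~~ (p %| ((-1) ^+ (m < 0)%R * d%:Z) * n')%Z.
  apply: ndvdzM => //; rewrite dvdzE abszM abszX /= exp1n mul1n.
  by rewrite -prime_coprime.
suff -> : ((-1) ^+ (m < 0)%R * d%:Z) * n' = p%:Z * (m' * n) by rewrite dvdz_mulr.
apply/eqP; rewrite -(inj_eq (@intr_inj rat)); apply/eqP.
have pij : p%:R ^+ (i + j) != 0 :> rat by rewrite expf_neq0.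
rewrite ![in RHS]rmorphM [LHS]rmorphM /= -[p%:~R]pmulrn; apply: (mulfI pij).
move: eq; rewrite e' exprSr => /(congr1 (fun x => x * n%:~R * n'%:~R)).
by rewrite divfK // -!mulrA [n%:~R * _]mulrC mulKf // => ->.
Qed.

(** * Maps without periodic points *)

Lemma iter_stable (X : Type) (S : X -> Prop) (T : X -> X) :
  (forall x, S x -> S (T x)) -> forall n x, S x -> S (iter n T x).
Proof. by move=> ST n x Sx; elim: n => //= n; apply: ST. Qed.

(** Write D x for the displacement z (T x) - z x.  By the contraction all the
    D (T^i x) agree with D x modulo p ^ (k + 2), so that m iterations displace
    by m * D x modulo p ^ (k + 2).  When p does not divide m this is nonzero.
    When m = p it has valuation exactly k + 1, and the displacement of T^p
    contracts as D does, so that an exponent n divisible by p is reduced to the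
    exponent n / p of T^p. *)
Lemma no_periodic_point (p : nat) (X : Type) (S : X -> Prop) (T : X -> X)
  (z : X -> rat) (k : nat) : prime p ->
  (forall x, S x -> S (T x)) ->
  (forall x, S x ->
     pdvd p k (z (T x) - z x) /\ ~ pdvd p k.+1 (z (T x) - z x)) ->
  (forall j x y, S x -> S y -> pdvd p j (z x - z y) ->
     pdvd p j.+2 ((z (T x) - z x) - (z (T y) - z y))) ->
  forall n x, (0 < n)%N -> S x -> iter n T x <> x.
Proof.
move=> pp ST step lip n; move: (ltnSn n); move: {2}n.+1 => N.
elim: N => // N IH in n T k ST step lip *; rewrite ltnS => nN x n0 Sx.
have SI m y : S y -> S (iter m T y) by apply: iter_stable.
pose D y := z (T y) - z y.
have sumE m y : z (iter m T y) - z y =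
    \sum_(i < m) D (iter i T y).
  elim: m => [|m IHm]; first by rewrite big_ord0 subrr.
  by rewrite big_ord_recr -IHm /D /=; ring.
have itk m y : S y -> pdvd p k (z (iter m T y) - z y).
  move=> Sy; rewrite sumE.
  apply: (@pdvd_sum p k m (fun i => D (iter i T y))) => // i.
  exact: (step _ (SI _ _ Sy)).1.
have near_mul m y : S y ->
    pdvd p k.+2 (z (iter m T y) - z y - m%:R * D y).
  move=> Sy; rewrite sumE mulr_natl -[m in X in _ - X]card_ord -sumr_const -sumrB.
  apply: (@pdvd_sum p _ m (fun i => D (iter i T y) - D y)) => // i.
  by apply: lip => //; [apply: SI | apply: itk].
have itlip j m y y' : S y -> S y' -> pdvd p j (z y - z y') ->
    pdvd p j (z (iter m T y) - z (iter m T y')) /\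
    pdvd p j.+2 ((z (iter m T y) - z y) - (z (iter m T y') - z y')).
  move=> Sy Sy' yy'; elim: m => [|m [IHm IHm2]] /=.
    by rewrite !subrr; split=> //; apply: pdvd0.
  have l := lip _ _ _ (SI m _ Sy) (SI m _ Sy') IHm; split.
    set a := iter m T y in IHm l *; set b := iter m T y' in IHm l *.
    have -> : z (T a) - z (T b) = (z a - z b) + (D a - D b) by rewrite /D; ring.
    by apply: pdvdD => //; apply: pdvdW l => //; lia.
  set a := iter m T y in IHm2 l *; set b := iter m T y' in IHm2 l *.
  have -> : (z (T a) - z y) - (z (T b) - z y') =
     (D a - D b) + ((z a - z y) - (z b - z y')) by rewrite /D; ring.
  exact: pdvdD.
have [pn|pn] := boolP (p %| n)%N; last first.
  move=> nx; have [_] := step _ Sx; apply.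
  apply: (pdvd_natMl pp pn); have := near_mul n x Sx.
  by rewrite nx subrr sub0r => /(pdvdN pp); rewrite opprK; apply: pdvdW.
have iterM m y : iter m (iter p T) y = iter (m * p) T y.
  by elim: m => //= m ->; rewrite mulSn iterD.
have := @IH (n %/ p)%N (iter p T) k.+1; rewrite -[in X in _ -> X](divnK pn) -iterM.
apply=> //.
- by move=> y; apply: SI.
- move=> y Sy; have [d1 d2] := step _ Sy; have := near_mul p y Sy.
  set e := _ - _ - _ => de.
  have -> : z (iter p T y) - z y = e + p%:R * D y by rewrite /e; ring.
  split.
    apply: pdvdD => //; first exact: pdvdW de.
    by apply: pdvdM (pdvd_p pp) d1.
  move=> d; apply: d2; apply: pdvd_pMl => //.
  have -> : p%:R * (z (T y) - z y) = e + p%:R * D y - e by rewrite /D; ring.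
  exact: pdvdB.
- by move=> j y y' Sy Sy' yy'; have [] := itlip j p y y' Sy Sy' yy'.
- by apply: leq_trans nN; rewrite ltn_Pdiv ?prime_gt1.
- by rewrite divn_gt0 ?prime_gt0 // dvdn_leq.
Qed.

(** * The curve and its chords near the point at infinity *)

(** The cubic y^2 = x^3 + s x^2 + t x + u in the coordinates z = x / y and
    w = 1 / y, where the point at infinity is the origin. *)
Definition wcurve (s t u z w : rat) : rat :=
  z ^+ 3 + s * z ^+ 2 * w + t * z * w ^+ 2 + u * w ^+ 3 - w.

(** The slope of the line through two points of the curve in the (z, w)-plane,
    written as a quotient with denominator 1 modulo p near the origin.  Unlike
    (w2 - w1) / (z2 - z1) it also gives the tangent when the points agree. *)
Definition slope_num (s t z1 w1 z2 : rat) : rat :=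
  z1 ^+ 2 + z1 * z2 + z2 ^+ 2 + s * w1 * (z1 + z2) + t * w1 ^+ 2.

Definition slope_den (s t u w1 z2 w2 : rat) : rat :=
  1 - s * z2 ^+ 2 - t * z2 * (w1 + w2) - u * (w1 ^+ 2 + w1 * w2 + w2 ^+ 2).

Lemma slopeE (s t u z1 w1 z2 w2 : rat) :
  (w2 - w1) * slope_den s t u w1 z2 w2 - (z2 - z1) * slope_num s t z1 w1 z2 =
    wcurve s t u z1 w1 - wcurve s t u z2 w2.
Proof. rewrite /slope_den /slope_num /wcurve; ring. Qed.

Definition slope (s t u z1 w1 z2 w2 : rat) : rat :=
  slope_num s t z1 w1 z2 / slope_den s t u w1 z2 w2.

(** Substituting w = l z + n in the curve gives a cubic in z with leading
    coefficient [lead] and next coefficient [shift_num].  Its roots sum to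
    - shift_num / lead, so that minus the third root, which is the coordinate
    of the sum, is z1 + z2 + [shift]. *)
Definition lead (s t u l : rat) : rat := 1 + s * l + t * l ^+ 2 + u * l ^+ 3.

Definition shift_num (s t u l n : rat) : rat := n * (s + 2 * t * l + 3 * u * l ^+ 2).

Definition shift (s t u z1 w1 z2 w2 : rat) : rat :=
  let l := slope s t u z1 w1 z2 w2 in
  shift_num s t u l (w1 - l * z1) / lead s t u l.

(** The first three hypotheses are the coefficients of
    f(x) - (l x + m)^2 = (x - x1) (x - x2) (x - x3), a form which covers chords
    and tangents alike.  The line y = l x + m is w = - l / m z + 1 / m. *)
Lemma line_sum_zw (s t u l m x1 x2 x3 y1 y2 y3 : rat) :
  l ^+ 2 - s = x1 + x2 + x3 ->
  t - 2 * l * m = x1 * x2 + x1 * x3 + x2 * x3 ->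
  m ^+ 2 - u = x1 * x2 * x3 ->
  y1 = l * x1 + m -> y2 = l * x2 + m -> y3 = - (l * x3 + m) ->
  m != 0 -> y1 != 0 -> y2 != 0 -> lead s t u (- l / m) != 0 ->
  [/\ y3 != 0,
      x3 / y3 = x1 / y1 + x2 / y2 +
        shift_num s t u (- l / m) m^-1 / lead s t u (- l / m)
    & y3^-1 = (- l / m) * (x3 / y3) - m^-1].
Proof.
move=> es et eu e1 e2 e3 m0 y10 y20 A0.
have s_eq : s = l ^+ 2 - (x1 + x2 + x3) by rewrite -es; ring.
have t_eq : t = 2 * l * m + (x1 * x2 + x1 * x3 + x2 * x3) by rewrite -et; ring.
have u_eq : u = m ^+ 2 - x1 * x2 * x3 by rewrite -eu; ring.
(* f - (l x + m)^2 at the zero - m / l of the line, cleared of denominators. *)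
have eA : lead s t u (- l / m) = - (y1 * y2 * y3) / m ^+ 3.
  by rewrite /lead s_eq t_eq u_eq e1 e2 e3; field.
have y30 : y3 != 0.
  by apply: contraNneq A0 => y30; rewrite eA y30 mulr0 oppr0 mul0r.
split=> //; last by rewrite e3; field; rewrite m0 -oppr_eq0 -e3.
rewrite eA /shift_num s_eq t_eq u_eq.
move: y10 y20 y30; rewrite e1 e2 e3 oppr_eq0 => y10 y20 y30.
by field; rewrite m0 y10 y20 y30.
Qed.

(** Decomposes a polynomial expression; in a product the right-hand factor has
    to carry the power of p. *)
Ltac pint := repeat first
  [ assumption | exact: pdvd0 | exact: pdvd_nat | exact: (pdvd_int 1)
  | apply: pdvdB | apply: pdvdN | apply: pdvdD | apply: pdvdMl
  | rewrite expr2 | rewrite exprS ].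

Definition formal_point (p : nat) (s t u z w : rat) : Prop :=
  [/\ pdvd p 1 z, pdvd p 1 w & wcurve s t u z w = 0].

Lemma formal_point0 (p : nat) (s t u : rat) :
  prime p -> formal_point p s t u 0 0.
Proof.
by move=> pp; split; [exact: pdvd0 | exact: pdvd0 | rewrite /wcurve; ring].
Qed.

Lemma slope_den_unit (p : nat) (s t u w1 z2 w2 : rat) : prime p ->
  pdvd p 0 s -> pdvd p 0 t -> pdvd p 0 u ->
  pdvd p 1 w1 -> pdvd p 1 z2 -> pdvd p 1 w2 ->
  pdvd p 1 (1 - slope_den s t u w1 z2 w2).
Proof.
move=> pp ps pt pu pw1 pz2 pw2.
have [qw1 qz2 qw2] : [/\ pdvd p 0 w1, pdvd p 0 z2 & pdvd p 0 w2].
  by split; apply: (pdvdW pp (leq0n 1)).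
have -> : 1 - slope_den s t u w1 z2 w2 =
   (s * z2 + t * (w1 + w2)) * z2 + u * w1 * w1 + (u * w1 + u * w2) * w2.
  rewrite /slope_den; ring.
by pint.
Qed.

Lemma pdvd_slope_num (p : nat) (s t z1 w1 z2 : rat) : prime p ->
  pdvd p 0 s -> pdvd p 0 t -> pdvd p 1 z1 -> pdvd p 1 w1 -> pdvd p 1 z2 ->
  pdvd p 2 (slope_num s t z1 w1 z2).
Proof.
move=> pp ps pt pz1 pw1 pz2.
have -> : slope_num s t z1 w1 z2 =
    z1 * z1 + z1 * z2 + z2 * z2 + s * (w1 * (z1 + z2)) + t * (w1 * w1).
  rewrite /slope_num; ring.
have two a b : pdvd p 1 a -> pdvd p 1 b -> pdvd p 2 (a * b) by apply: pdvdM.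
do !apply: pdvdD => //; do ?exact: two.
  by apply: pdvdMl => //; apply: two => //; apply: pdvdD.
by apply: pdvdMl => //; apply: two.
Qed.

Lemma pdvd_slope (p : nat) (s t u z1 w1 z2 w2 : rat) : prime p ->
  pdvd p 0 s -> pdvd p 0 t -> pdvd p 0 u ->
  pdvd p 1 z1 -> pdvd p 1 w1 -> pdvd p 1 z2 -> pdvd p 1 w2 ->
  pdvd p 2 (slope s t u z1 w1 z2 w2).
Proof.
move=> pp *; apply: pdvd_div => //; first exact: slope_den_unit.
exact: pdvd_slope_num.
Qed.

Lemma lead_unit (p : nat) (s t u l : rat) : prime p ->
  pdvd p 0 s -> pdvd p 0 t -> pdvd p 0 u -> pdvd p 1 l ->
  pdvd p 1 (1 - lead s t u l).
Proof.
move=> pp ps pt pu pl; have ql := pdvdW pp (leq0n 1) pl.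
have -> : 1 - lead s t u l = - ((s + t * l + u * l * l) * l) by rewrite /lead; ring.
by pint.
Qed.

Lemma pdvd_shift (p : nat) (s t u z1 w1 z2 w2 : rat) : prime p ->
  pdvd p 0 s -> pdvd p 0 t -> pdvd p 0 u ->
  pdvd p 1 z1 -> pdvd p 1 w1 -> pdvd p 1 z2 -> pdvd p 1 w2 ->
  pdvd p 1 (shift s t u z1 w1 z2 w2).
Proof.
move=> pp ps pt pu pz1 pw1 pz2 pw2.
have pl : pdvd p 1 (slope s t u z1 w1 z2 w2).
  by apply: (@pdvdW p 2) => //; apply: pdvd_slope.
have ql := pdvdW pp (leq0n 1) pl.
rewrite /shift; apply: pdvd_div => //; first exact: lead_unit.
by apply: pdvdMr => //; pint.
Qed.

Lemma formal_slopeE (p : nat) (s t u z1 w1 z2 w2 : rat) : prime p ->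
  pdvd p 0 s -> pdvd p 0 t -> pdvd p 0 u ->
  formal_point p s t u z1 w1 -> formal_point p s t u z2 w2 ->
  w1 - w2 = (z1 - z2) * slope s t u z1 w1 z2 w2.
Proof.
move=> pp ps pt pu [_ pw1 e1] [pz2 pw2 e2].
have M0 := punit_neq0 pp (slope_den_unit pp ps pt pu pw1 pz2 pw2).
apply: (mulIf M0); rewrite /slope -mulrA divfK //.
apply/eqP; rewrite -eqr_opp -!mulNr !opprB -subr_eq0 slopeE e1 e2 subrr //.
Qed.

Lemma formal_lipschitz (p j : nat) (s t u z1 w1 z2 w2 : rat) : prime p ->
  pdvd p 0 s -> pdvd p 0 t -> pdvd p 0 u ->
  formal_point p s t u z1 w1 -> formal_point p s t u z2 w2 ->
  pdvd p j (z1 - z2) -> pdvd p j (w1 - w2).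
Proof.
move=> pp ps pt pu f1 f2 z12; rewrite (formal_slopeE pp ps pt pu f1 f2).
case: f1 f2 => pz1 pw1 _ [pz2 pw2 _]; apply: pdvdMr => //.
by apply: (@pdvdW p 2) => //; apply: pdvd_slope.
Qed.

(** One factor p of the contraction comes from [slope_num], which is quadratic,
    so that the slope moves by p^(j + 1); the other one comes from the
    intercept w1 - l z1, which moves by z1 times as much and which divides the
    shift. *)
Lemma shift_lipschitz (p j : nat) (s t u z1 w1 z w z' w' : rat) : prime p ->
  pdvd p 0 s -> pdvd p 0 t -> pdvd p 0 u ->
  formal_point p s t u z1 w1 -> formal_point p s t u z w ->
  formal_point p s t u z' w' -> pdvd p j (z - z') ->
  pdvd p j.+2 (shift s t u z1 w1 z w - shift s t u z1 w1 z' w').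
Proof.
move=> pp ps pt pu [pz1 pw1 e1] fz fz' zz'.
have ww' := formal_lipschitz pp ps pt pu fz fz' zz'.
case: fz fz' => pz pw e [pz' pw' e'].
have W1 a : pdvd p 1 a -> pdvd p 0 a by apply: pdvdW.
have W2 a : pdvd p 2 a -> pdvd p 1 a by apply: pdvdW.
have [qz1 qw1 qz qw] : [/\ pdvd p 0 z1, pdvd p 0 w1, pdvd p 0 z & pdvd p 0 w].
  by split; apply: W1.
have [qz' qw'] : pdvd p 0 z' /\ pdvd p 0 w' by split; apply: W1.
have mulS i a b : pdvd p i a -> pdvd p 1 b -> pdvd p i.+1 (a * b).
  by apply: pdvdM; rewrite ?addn1.
pose M := slope_den s t u w1 z w; pose M' := slope_den s t u w1 z' w'.
pose N := slope_num s t z1 w1 z; pose N' := slope_num s t z1 w1 z'.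
have dN : pdvd p j.+1 (N - N').
  have -> : N - N' = (z - z') * (z1 + z + z' + s * w1).
    rewrite /N /N' /slope_num; ring.
  by apply: mulS => //; pint.
have dM : pdvd p j.+1 (M - M').
  have -> : M - M' = (z - z') * - (s * (z + z') + t * (w1 + w)) +
      (w - w') * - (t * z' + u * (w1 + w + w')).
    rewrite /M /M' /slope_den; ring.
  by apply: pdvdD => //; apply: mulS => //; pint.
have uM : pdvd p 1 (1 - M) by apply: slope_den_unit.
have uM' : pdvd p 1 (1 - M') by apply: slope_den_unit.
pose l := slope s t u z1 w1 z w; pose l' := slope s t u z1 w1 z' w'.
have pl : pdvd p 1 l by apply: W2; apply: pdvd_slope.
have pl' : pdvd p 1 l' by apply: W2; apply: pdvd_slope.
have [ql ql'] : pdvd p 0 l /\ pdvd p 0 l' by split; apply: W1.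
have dl : pdvd p j.+1 (l - l').
  apply: pdvd_cong_div => //; apply: pdvdMl => //.
  by apply: (@pdvdW p 2) => //; apply: pdvd_slope_num.
pose n := w1 - l * z1; pose n' := w1 - l' * z1.
have pn' : pdvd p 1 n' by rewrite /n'; pint.
have qn' := W1 _ pn'.
have dn : pdvd p j.+2 (n - n').
  have -> : n - n' = - ((l - l') * z1) by rewrite /n /n'; ring.
  by apply: pdvdN => //; apply: mulS.
apply: pdvd_cong_div => //; try exact: lead_unit; rewrite -/l -/l' -/n -/n'.
  have -> : shift_num s t u l n - shift_num s t u l' n' =
      (n - n') * (s + 2 * t * l + 3 * u * l ^+ 2) +
      (l - l') * n' * (2 * t + 3 * u * (l + l')).
    rewrite /shift_num; ring.
  apply: pdvdD => //; apply: pdvdMr => //; [by pint | exact: mulS | by pint].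
have -> : shift_num s t u l' n' * (lead s t u l - lead s t u l') =
    (l - l') * n' * ((s + 2 * t * l' + 3 * u * l' ^+ 2) *
      (s + t * (l + l') + u * (l ^+ 2 + l * l' + l' ^+ 2))).
  rewrite /shift_num /lead; ring.
by apply: pdvdMr => //; [exact: mulS | pint].
Qed.

(** * Addition of points near infinity *)

Definition zcoord (P : option (rat * rat)) : rat :=
  if P is Some (x, y) then x / y else 0.

Definition wcoord (P : option (rat * rat)) : rat :=
  if P is Some (x, y) then y^-1 else 0.

(** Points reducing to the point at infinity modulo p.  The points of order 2
    are excluded by hand: the conventions x / 0 = 0 and 1 / 0 = 0 would
    otherwise place them at the origin of the (z, w)-plane. *)
Definition near_infinity (p : nat) (P : option (rat * rat)) : Prop :=
  if P is Some (x, y) then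
    [/\ y != 0, pdvd p 1 (x / y) & pdvd p 1 y^-1]
  else True.

Definition p_integral (p : nat) (E : elliptic_curve) : Prop :=
  forall i : nat, pdvd p 0 (cubic E)`_i.

Lemma near_infinity_formal (p : nat) (E : elliptic_curve) P : prime p ->
  on_curve E P -> near_infinity p P ->
  formal_point p (cubic E)`_2 (cubic E)`_1 (cubic E)`_0 (zcoord P) (wcoord P).
Proof.
move=> pp; case: P => [[x y]|] /=; last by move=> *; apply: formal_point0.
rewrite horner_cubic => /eqP e [y0 pz pw]; split=> //.
set s := _`_2 in e *; set t := _`_1 in e *; set u := _`_0 in e *.
have -> : u = y ^+ 2 - (x ^+ 3 + s * x ^+ 2 + t * x) by rewrite e; ring.
by rewrite /wcurve; field.
Qed.

(** The common part of the chord and tangent cases.  The last hypothesis says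
    that [slope] is the slope - l / m of the line y = l x + m in the plane of z
    and w; it also forces m != 0, since m = 0 would give l = 0 and then
    y1 = 0. *)
Lemma line_sum_near_infinity (p : nat) (E : elliptic_curve) (l m x1 y1 x2 y2 : rat)
  (s := (cubic E)`_2) (t := (cubic E)`_1) (u := (cubic E)`_0)
  (x3 := l ^+ 2 - s - x1 - x2) :
  prime p -> p_integral p E ->
  near_infinity p (Some (x1, y1)) -> near_infinity p (Some (x2, y2)) ->
  t - 2 * l * m = x1 * x2 + x1 * x3 + x2 * x3 -> m ^+ 2 - u = x1 * x2 * x3 ->
  y1 = l * x1 + m -> y2 = l * x2 + m ->
  m * slope s t u (x1 / y1) y1^-1 (x2 / y2) y2^-1 = - l ->
  near_infinity p (Some (line_sum E l x1 y1 x2)) /\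
  zcoord (Some (line_sum E l x1 y1 x2)) =
    x1 / y1 + x2 / y2 + shift s t u (x1 / y1) y1^-1 (x2 / y2) y2^-1.
Proof.
move=> pp iE [y10 pz1 pw1] [y20 pz2 pw2] et eu e1 e2.
have [ps pt pu] : [/\ pdvd p 0 s, pdvd p 0 t & pdvd p 0 u] by split; apply: iE.
have pl := pdvd_slope pp ps pt pu pz1 pw1 pz2 pw2.
have psh := pdvd_shift pp ps pt pu pz1 pw1 pz2 pw2.
move: pl psh; rewrite /shift; set lam := slope _ _ _ _ _ _ _ => pl psh el.
have pl1 : pdvd p 1 lam by apply: pdvdW pl.
have m0 : m != 0.
  apply: contraNneq y10 => m0; move/eqP: el.
  by rewrite m0 mul0r eq_sym oppr_eq0 => /eqP l0; rewrite e1 l0 m0 mul0r add0r.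
have elam : lam = - l / m by rewrite -el mulrC mulKf.
have A0 := punit_neq0 pp (lead_unit pp ps pt pu pl1).
have nu : y1^-1 - lam * (x1 / y1) = m^-1.
  by rewrite elam; move: y10; rewrite e1 => y10; field; rewrite m0.
have es : l ^+ 2 - s = x1 + x2 + x3 by rewrite /x3; ring.
have e3 : l * (x1 - x3) - y1 = - (l * x3 + m) by rewrite e1; ring.
rewrite elam in A0.
have [y30 z3 w3] := line_sum_zw es et eu e1 e2 e3 m0 y10 y20 A0.
rewrite -elam in z3 w3; rewrite nu in psh *.
rewrite /line_sum -/s -/x3 /=; split=> //.
have pz3 : pdvd p 1 (x3 / (l * (x1 - x3) - y1)).
  by rewrite z3; apply: pdvdD => //; apply: pdvdD.
split=> //; rewrite w3 -nu; apply: pdvdB => //.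
  by apply: pdvdMl => //; apply: pdvdW pl.
by apply: pdvdB => //; apply: pdvdMl => //; apply: pdvdW pl.
Qed.

(** A single formula covers all cases of the addition law: when one point is at
    infinity or the points are opposite, the line passes through the origin of
    the (z, w)-plane, and the shift, a multiple of the intercept, vanishes. *)
Lemma add_near_infinity (p : nat) (E : elliptic_curve) (P Q : option (rat * rat)) :
  prime p -> p_integral p E -> on_curve E P -> on_curve E Q ->
  near_infinity p P -> near_infinity p Q ->
  near_infinity p (add_coords E P Q) /\
  zcoord (add_coords E P Q) = zcoord P + zcoord Q +
    shift (cubic E)`_2 (cubic E)`_1 (cubic E)`_0
      (zcoord P) (wcoord P) (zcoord Q) (wcoord Q).
Proof.
move=> pp iE cP cQ nP nQ.
have fP := near_infinity_formal pp cP nP.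
have fQ := near_infinity_formal pp cQ nQ.
set s := _`_2 in fP fQ *; set t := _`_1 in fP fQ *; set u := _`_0 in fP fQ *.
have [ps pt pu] : [/\ pdvd p 0 s, pdvd p 0 t & pdvd p 0 u] by split; apply: iE.
have slE := formal_slopeE pp ps pt pu fP fQ.
have D0 : slope_den s t u (wcoord P) (zcoord Q) (wcoord Q) != 0.
  case: fP fQ => _ pw1 _ [pz2 pw2 _].
  by apply: (punit_neq0 pp); apply: slope_den_unit.
have shift0 : wcoord P = zcoord P *
      slope s t u (zcoord P) (wcoord P) (zcoord Q) (wcoord Q) ->
    shift s t u (zcoord P) (wcoord P) (zcoord Q) (wcoord Q) = 0.
  move=> e; rewrite /shift /shift_num [slope _ _ _ _ _ _ _ * zcoord P]mulrC.
  by rewrite -e subrr !mul0r.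
case: P Q => [[x1 y1]|] [[x2 y2]|] in cP cQ nP nQ fP fQ D0 slE shift0 *; last first.
- by rewrite /= shift0 /= ?mul0r // !addr0.
- by rewrite /= shift0 /= ?mul0r // addr0 add0r.
- rewrite /= shift0 /= ?addr0 //.
  by move: slE; rewrite /= !subr0.
move: cP cQ => /=; rewrite !horner_cubic -/s -/t -/u => /eqP c1 /eqP c2.
have [y10 _ _] := nP; have [y20 _ _] := nQ.
case: ifPn => [x12|].
  have dx : x2 - x1 != 0 by rewrite subr_eq0 eq_sym.
  set l := (y2 - y1) / (x2 - x1).
  have el : l * (x2 - x1) = y2 - y1 by rewrite divfK.
  pose m := y1 - l * x1.
  have e1 : y1 = l * x1 + m by rewrite /m; ring.
  have e2 : y2 = l * x2 + m by rewrite /m -[y2](subrK y1) -el; ring.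
  have et : t - 2 * l * m = x1 * x2 + x1 * (l ^+ 2 - s - x1 - x2) +
      x2 * (l ^+ 2 - s - x1 - x2).
    (* The divided difference of f - (l x + m)^2 between its zeros x1 and x2. *)
    apply: (mulfI dx); apply/eqP; rewrite -subr_eq0; apply/eqP.
    transitivity ((x2 ^+ 3 + s * x2 ^+ 2 + t * x2 + u - y2 ^+ 2) -
      (x1 ^+ 3 + s * x1 ^+ 2 + t * x1 + u - y1 ^+ 2)).
      by rewrite e1 e2; ring.
    by rewrite c1 c2; ring.
  have eu : m ^+ 2 - u = x1 * x2 * (l ^+ 2 - s - x1 - x2).
    have -> : u = y1 ^+ 2 - (x1 ^+ 3 + s * x1 ^+ 2 + t * x1) by rewrite c1; ring.
    by rewrite -[t](subrK (2 * l * m)) et e1; ring.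
  apply: (line_sum_near_infinity pp iE _ _ et eu e1 e2) => //.
  (* If the z agree, then so do the w, because the slope is finite. *)
  have dz : x1 / y1 - x2 / y2 != 0.
    apply: contraNneq x12 => dz; move/eqP: slE.
    rewrite /= dz mul0r subr_eq0 => /eqP/invr_inj y12.
    move/eqP: dz; rewrite y12 -mulrBl mulf_eq0 invr_eq0 (negPf y20) orbF.
    by rewrite subr_eq0.
  apply: (mulfI dz).
  rewrite mulrCA -slE /= mulrN -mulNr.
  move: y10 y20; rewrite e1 e2 => y10 y20; field; rewrite ?y10 ?y20 //.
rewrite negbK => /eqP ex; subst x2.
case: ifPn => [/eqP ny|ny].
  have w12 : y1^-1 = - y2^-1 by rewrite ny invrN.
  have z12 : x1 / y1 = - (x1 / y2) by rewrite w12 mulrN.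
  split=> //; rewrite shift0; first by rewrite addr0 z12 addNr.
  move: slE => /=; set S := slope _ _ _ _ _ _ _ => slE.
  (* Opposite points: w1 - w2 = (z1 - z2) * slope reads 2 w1 = 2 z1 * slope. *)
  apply: (@mulfI _ 2) => //.
  transitivity (y1^-1 - y2^-1).
    by rewrite w12; ring.
  by rewrite slE z12; ring.
have ey : y1 = y2.
  have /eqP : (y1 - y2) * (y1 + y2) = 0.
    by transitivity (y1 ^+ 2 - y2 ^+ 2); [ring | rewrite c1 c2 subrr].
  by rewrite mulf_eq0 subr_eq0 addr_eq0 (negPf ny) orbF => /eqP.
subst y2.
set l := _ / _.
have el : 2 * l * y1 = 3 * x1 ^+ 2 + 2 * s * x1 + t.
  by rewrite /l horner_deriv_cubic -/s -/t; field.
pose m := y1 - l * x1.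
have e1 : y1 = l * x1 + m by rewrite /m; ring.
have et : t - 2 * l * m = x1 * x1 + x1 * (l ^+ 2 - s - x1 - x1) +
    x1 * (l ^+ 2 - s - x1 - x1).
  have -> : t = 2 * l * y1 - (3 * x1 ^+ 2 + 2 * s * x1) by rewrite el; ring.
  by rewrite /m; ring.
have eu : m ^+ 2 - u = x1 * x1 * (l ^+ 2 - s - x1 - x1).
  have -> : u = y1 ^+ 2 - (x1 ^+ 3 + s * x1 ^+ 2 + t * x1) by rewrite c1; ring.
  by rewrite -[t](subrK (2 * l * m)) et e1; ring.
apply: (line_sum_near_infinity pp iE _ _ et eu e1 e1) => //.
move: D0 => /= D0.
have eN : slope_num s t (x1 / y1) y1^-1 (x1 / y1) = 2 * l / y1.
  rewrite /slope_num; apply: (mulIf y10); rewrite divfK //.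
  have -> : 2 * l = 2 * l * y1 / y1 by rewrite mulfK.
  by rewrite el; field.
have eD : slope_den s t u y1^-1 (x1 / y1) y1^-1 = - 2 * m / y1.
  rewrite /slope_den; apply: (mulIf y10); rewrite divfK //.
  have -> : - 2 * m = (2 * l * y1 * x1 - 2 * y1 ^+ 2) / y1 by rewrite /m; field.
  have -> : u = y1 ^+ 2 - (x1 ^+ 3 + s * x1 ^+ 2 + t * x1) by rewrite c1; ring.
  by rewrite el; field.
have m0 : m != 0 by apply: contraNneq D0 => m0; rewrite eD m0 mulr0 mul0r.
by rewrite /slope eN eD; field; rewrite y10.
Qed.

(** * Points of infinite order *)

Lemma coords_inj (E : elliptic_curve) : injective (@coords E).
Proof.
case=> P cP [Q cQ] /= ePQ; subst Q.
by congr (Point _); apply: bool_irrelevance.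
Qed.

(** The domain of the translation by Q is taken to be the points X near infinity
    with p^k | z(X), k being the valuation of z(Q); comparing X with the point
    at infinity then gives displacement z(Q) modulo p ^ (k + 2). *)
Lemma near_infinity_nontorsion (p : nat) (E : elliptic_curve) (Q : point E) :
  prime p -> p_integral p E -> near_infinity p (coords Q) -> Q <> point0 E ->
  ~ torsion Q.
Proof.
move=> pp iE nQ Q0 [n n0 nQ0].
set s := (cubic E)`_2; set t := (cubic E)`_1; set u := (cubic E)`_0.
have [ps pt pu] : [/\ pdvd p 0 s, pdvd p 0 t & pdvd p 0 u] by split; apply: iE.
have fQ := near_infinity_formal pp (coords_on_curve Q) nQ.
have [pz pw eQ] := fQ.
have add X := @add_near_infinity p E (coords Q) (coords X) pp iE
  (coords_on_curve Q) (coords_on_curve X) nQ.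
(* Joined to the origin by a line of finite slope, a point with z = 0 also has
   w = 0, and is the point at infinity. *)
have z0 : zcoord (coords Q) != 0.
  apply/eqP => z0; apply: Q0; apply: coords_inj.
  have := formal_slopeE pp ps pt pu fQ (formal_point0 s t u pp).
  rewrite z0 subrr mul0r subr0.
  case: (coords Q) nQ => [[x y]|] //= [y0 _ _].
  by move/eqP; rewrite invr_eq0 (negPf y0).
have [k [k1 zk zk1]] := exact_pdvd pp z0 pz.
have stepE X : near_infinity p (coords X) ->
    zcoord (coords (addp Q X)) - zcoord (coords X) = zcoord (coords Q) +
      shift s t u (zcoord (coords Q)) (wcoord (coords Q))
        (zcoord (coords X)) (wcoord (coords X)).
  by move=> /add [_]; rewrite /= => ->; rewrite -/s -/t -/u; ring.
(* The addition formula for Q + 0 = Q. *)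
have shift0 : shift s t u (zcoord (coords Q)) (wcoord (coords Q)) 0 0 = 0.
  have := stepE (point0 E) I; rewrite /= subr0.
  case: (coords Q) => [[x y]|] /= /eqP; last by rewrite add0r eq_sym => /eqP.
  by rewrite -subr_eq0 opprD addrA subrr sub0r oppr_eq0 => /eqP.
have lip j X Y : near_infinity p (coords X) -> near_infinity p (coords Y) ->
    pdvd p j (zcoord (coords X) - zcoord (coords Y)) ->
    pdvd p j.+2 ((zcoord (coords (addp Q X)) - zcoord (coords X)) -
                 (zcoord (coords (addp Q Y)) - zcoord (coords Y))).
  move=> nX nY XY; rewrite !stepE // opprD addrACA subrr add0r.
  apply: shift_lipschitz => //; apply: near_infinity_formal => //;
    exact: coords_on_curve.
have step X : near_infinity p (coords X) -> pdvd p k (zcoord (coords X)) ->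
    pdvd p k.+2 (zcoord (coords (addp Q X)) - zcoord (coords X) - zcoord (coords Q)).
  move=> nX kX; have := @lip k X (point0 E) nX I.
  rewrite [X in _ - (X - _)]/= subr0 => /(_ kX).
  by rewrite (stepE (point0 E) I) /= shift0 addr0.
have := @no_periodic_point p (point E)
  (fun X => near_infinity p (coords X) /\ pdvd p k (zcoord (coords X)))
  (addp Q) (fun X => zcoord (coords X)) k pp.
move=> /(_ _ _ _ n (point0 E) n0 (conj I (pdvd0 k pp)) nQ0); apply.
- move=> X [nX kX]; split; first by have [] := add X nX.
  have := pdvdW pp (leq_trans (leqnSn k) (leqnSn k.+1)) (step _ nX kX) => d.
  rewrite -[zcoord (coords (addp Q X))](subrK (zcoord (coords X))).
  rewrite -[X in X + _](subrK (zcoord (coords Q))).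
  by do 2!apply: pdvdD => //.
- move=> X [nX kX]; have d := step _ nX kX.
  set e := zcoord (coords (addp Q X)) - zcoord (coords X) in d *.
  rewrite -[e](subrK (zcoord (coords Q))); split.
    by apply: pdvdD => //; apply: pdvdW d => //; lia.
  move=> d'; apply: zk1.
  rewrite -[zcoord _](addKr (e - zcoord (coords Q))) addrC; apply: pdvdB => //.
  exact: pdvdW d.
- by move=> j X Y [nX _] [nY _]; apply: lip.
Qed.

(** The second component of an isomorphism onto Z^0 x E(Q)_tors is additive, and
    it fixes the point at infinity since no other point is its own double. *)
Lemma rank0_torsion (E : elliptic_curve) : has_rank E 0 ->
  forall P : point E, torsion P.
Proof.
move=> [f [fD finj fim]] P.
have f0 : (f (point0 E)).2 = point0 E.
  have : (f (point0 E)).2 = addp (f (point0 E)).2 (f (point0 E)).2.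
    have O2 : addp (point0 E) (point0 E) = point0 E by apply: coords_inj.
    by have /(congr1 snd) := fD (point0 E) (point0 E); rewrite O2.
  move: (f _).2 => T /(congr1 (@coords E)) eT; apply: coords_inj.
  rewrite /= in eT; case: (coords T) eT => [[x y]|] // ; rewrite /add_coords eqxx.
  case: ifPn => // ny [ex ey]; case/eqP: ny.
  by rewrite {1}ey -ex subrr mulr0 sub0r.
have fn n : (f (iter n (addp P) (point0 E))).2 =
    iter n (addp (f P).2) (point0 E).
  by elim: n => //= n IH; rewrite fD /= IH.
have [n n0 nT] : torsion (f P).2.
  by apply/(fim (f P).1); exists P; case: (f P).
exists n => //; apply: finj; have := fn n; rewrite nT -[RHS]f0.
move: (f (iter _ _ _)) (f (point0 E)) => [v T] [v' T'] /= ->.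
by congr (_, _); rewrite [v]thinmx0 [v']thinmx0.
Qed.

(** * The curve of a Pythagorean triple *)

Lemma ppt_cubic_expand (a c : nat) : ppt_cubic a c =
  'X^3 + (c%:R ^+ 2 - a%:R ^+ 2)%:P * 'X^2 - (a%:R ^+ 2 * c%:R ^+ 2)%:P * 'X.
Proof. by rewrite /ppt_cubic polyCB polyCM; ring. Qed.

Lemma ppt_curve_integral (p a b c : nat) (abc : primitive_pythagorean_triple a b c) :
  prime p -> p_integral p (ppt_curve abc).
Proof.
move=> pp i /=.
rewrite ppt_cubic_expand.
by rewrite !(coefD, coefN, coefCM, coefXn, coefX); pint.
Qed.

(** Modulo 2 the number is a^4 + a^2 b^2 + b^4, which is even only if both a and
    b are, and then c would be even too. *)
Lemma ppt_odd (a b c : nat) : primitive_pythagorean_triple a b c ->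
  odd (b ^ 4 + a ^ 2 * c ^ 2).
Proof.
move=> [_ e g].
have : odd a || odd b.
  apply: contra_eqT g; rewrite negb_or => /andP[oa ob].
  have oc : ~~ odd c.
    by move: (congr1 odd e); rewrite oddD !oddX /= (negPf oa) (negPf ob) => <-.
  have : (2 %| gcdn a (gcdn b c))%N by rewrite !dvdn_gcd !dvdn2 oa ob oc.
  by apply: contraTneq => ->.
have oc : odd c = odd a (+) odd b.
  by move: (congr1 odd e); rewrite oddD !oddX /= => <-.
by rewrite oddD oddM !oddX /= oc; case: (odd a); case: (odd b).
Qed.

(** The point is the double of (- b^2, abc).  Its ordinate is
    - N W / (2abc)^3 with N = B + C and W = B^2 + 4BC - C^2, where B = b^4 and
    C = a^2 c^2; modulo 2 both N and W are B + C, hence odd. *)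
Lemma ppt_curve_nontorsion (a b c : nat) (abc : primitive_pythagorean_triple a b c) :
  exists Q : point (ppt_curve abc), ~ torsion Q.
Proof.
have [[a0 b0 c0] e _] := abc.
have eR : c%:R ^+ 2 = a%:R ^+ 2 + b%:R ^+ 2 :> rat by rewrite -!natrX -natrD e.
have [aR bR cR] : [/\ a%:R != 0 :> rat, b%:R != 0 :> rat & c%:R != 0 :> rat].
  by rewrite !pnatr_eq0 -!lt0n.
pose B : int := b%:Z ^+ 4; pose C : int := a%:Z ^+ 2 * c%:Z ^+ 2.
pose N := B + C; pose W := B ^+ 2 + 4 * B * C - C ^+ 2.
have oN : ~~ (2 %| N)%Z.
  have -> : N = (b ^ 4 + a ^ 2 * c ^ 2)%N.
    by rewrite /N /B /C PoszD PoszM -!natz !natrX !natz.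
  by rewrite dvdzE /= dvdn2 negbK; apply: ppt_odd abc.
have oW : ~~ (2 %| W)%Z.
  have -> : W = N * N + 2 * (B * C - C ^+ 2) by rewrite /W /N; ring.
  by rewrite rpredDr; [apply: (@ndvdzM 2) | exact: dvdz_mulr].
have NR : N%:~R = b%:R ^+ 4 + a%:R ^+ 2 * c%:R ^+ 2 :> rat.
  by rewrite /N /B /C !(rmorphD, rmorphM, rmorphXn) /= -!pmulrn.
have WR : W%:~R = b%:R ^+ 8 + 4 * b%:R ^+ 4 * (a%:R ^+ 2 * c%:R ^+ 2) -
    a%:R ^+ 4 * c%:R ^+ 4 :> rat.
  rewrite /W /B /C !(rmorphB, rmorphD, rmorphM, rmorphXn) /= -!pmulrn; ring.
have [N0 W0] := (ndvdz_neq0 oN, ndvdz_neq0 oW).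
set x0 : rat := - b%:R ^+ 2; set y0 : rat := a%:R * b%:R * c%:R.
have y00 : y0 != 0 by rewrite !mulf_neq0.
have onE : on_curve (ppt_curve abc) (Some (x0, y0)).
  rewrite /= /ppt_cubic !hornerE /x0 /y0; apply/eqP.
  rewrite !exprMn eR; ring.
pose Q := addp (Point onE) (Point onE).
have eQ : coords Q =
    Some (N%:~R ^+ 2 / (2 * y0) ^+ 2, - (N%:~R * W%:~R) / (2 * y0) ^+ 3).
  have ny : y0 == - y0 = false.
    by rewrite -addr_eq0 -mulr2n -mulr_natr mulf_eq0 (negPf y00).
  rewrite [LHS]/(add_coords _ (Some (x0, y0)) (Some (x0, y0))) /add_coords eqxx ny.
  rewrite /line_sum horner_deriv_cubic /= ppt_cubic_expand.
  rewrite !(coefD, coefN, coefCM, coefXn, coefX) /= NR WR.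
  have -> : c%:R ^+ 2 - a%:R ^+ 2 = b%:R ^+ 2 :> rat by rewrite eR; ring.
  by congr (Some (_, _)); rewrite /x0 /y0; field; rewrite aR bR cR.
pose Y : int := (a * b * c)%N.
have yR : Y%:~R = y0 :> rat by rewrite -pmulrn !natrM.
exists Q.
apply: (@near_infinity_nontorsion 2) => //; first exact: ppt_curve_integral.
  rewrite eQ; split.
  - by rewrite mulf_neq0 ?oppr_eq0 ?invr_eq0 ?mulf_neq0 ?expf_neq0 ?mulf_neq0.
  - exists (- Y * N), W; split=> //.
    rewrite expr1 intrM intrN yR.
    by move: (N%:~R) (W%:~R) N0 W0 => n w n0 w0; field; rewrite ?n0 w0 ?y00.
  - exists (- 4 * (Y * Y * Y)), (N * W); split; first exact: (@ndvdzM 2).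
    rewrite expr1 !intrM intrN yR.
    by move: (N%:~R) (W%:~R) N0 W0 => n w n0 w0; field; rewrite ?n0 w0 ?y00.
by move=> /(congr1 (@coords _)); rewrite eQ.
Qed.

Theorem theorem8p1 (a b c : nat) (abc : primitive_pythagorean_triple a b c)
  (r : nat) (hr : has_rank (ppt_curve abc) r) : (0 < r)%N.
Proof.
case: r hr => // /rank0_torsion all_torsion.
by have [Q] := ppt_curve_nontorsion abc; case; apply: all_torsion.
Qed.
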